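(* Let $r,s\ge1$, let $a_1,\dots,a_r,b_1,\dots,b_s,\alpha,\beta,z\in\mathbb{C}$ with $z\ne0$ satisfy the standing assumption of the context, assume all series below converge absolutely, and let $\kappa\ge1$ be an integer. Write ${}_rR_{s,q}={}_rR_{s,q}(a_1,\dots,a_r;b_1,\dots,b_s;\alpha,\beta;z)$. Then for every $i\in\{1,\dots,r\}$ with $a_i\ne0$, $$(D_{a_i,q})^\kappa\,{}_rR_{s,q}=\frac{(-1)^\kappa q^{\binom{\kappa}{2}}}{(a_i;q)_\kappa}\,z^\kappa (D_{z,q})^\kappa\,{}_rR_{s,q},$$ and for every $j\in\{1,\dots,s\}$ with $b_j\neq0$, $$(D_{b_j,q})^\kappa\,{}_rR_{s,q}=\frac{z}{(b_j;q)_\kappa}\,(D_{z,q})^\kappa\left[z^{\kappa-1}\,{}_rR_{s,q}(b_jq^\kappa)\right].$$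
   Context: Let $q\in\mathbb{C}$, $0<|q|<1$. $(a;q)_0=1$, $(a;q)_n=\prod_{i=0}^{n-1}(1-aq^i)$ for $n\ge1$, $(a;q)_\infty=\prod_{i\ge0}(1-aq^i)$. The $q$-gamma function is $\Gamma_q(x)=\frac{(q;q)_\infty}{(q^x;q)_\infty}(1-q)^{1-x}$ (principal logarithms), and $1/\Gamma_q(x)$ is read as $0$ at its poles. The basic function ${}_rR_{s,q}$ is $${}_rR_{s,q}(a_1,\dots,a_r;b_1,\dots,b_s;\alpha,\beta;z)=\sum_{\ell=0}^\infty\frac{z^\ell(-1)^{(1+s-r)\ell}q^{(1+s-r)\binom{\ell}{2}}}{(q;q)_\ell\,\Gamma_q(\ell\alpha+\beta)}\,\frac{\prod_{i=1}^r(a_i;q)_\ell}{\prod_{j=1}^s(b_j;q)_\ell}.$$ Standing assumption: $a_iq^\ell\ne1$ and $b_jq^\ell\neq1$ for all $i,j$ and all integers $\ell\ge0$. For a variable $x$ (here $x$ is $z$, $a_i$ or $b_j$, all other quantities being held fixed) the $q$-derivative is $(D_{x,q}f)(x)=\frac{f(x)-f(qx)}{(1-q)x}$, $x\neq0$, and $(D_{x,q})^\kappa$ is its $\kappa$-fold iterate. Notation: ${}_rR_{s,q}(b_jq^\kappa)$ is the same function with only $b_j$ replaced by $b_jq^\kappa$. *)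

(* Defs.v *)
(* Stdlib reals with Coquelicot's complex numbers. *)
From Stdlib Require Import Reals ZArith Arith Lra.
From Coquelicot Require Export Coquelicot.

Open Scope C_scope.

Definition Cexp (w : C) : C :=
  (exp (Re w) * cos (Im w), exp (Re w) * sin (Im w))%R.

(* Principal argument, with values in (-PI, PI] for w <> 0. *)
Definition Carg (w : C) : R :=
  if Rle_dec 0 (Im w) then acos (Re w / Cmod w) else (- acos (Re w / Cmod w))%R.

Definition Clog (w : C) : C := (ln (Cmod w), Carg w).

(* Principal power w^x, meaningful for w <> 0. *)
Definition Cpower (w x : C) : C := Cexp (x * Clog w).

Definition CpowerZ (w : C) (k : Z) : C :=
  match k with
  | Z0 => 1
  | Zpos p => w ^ Pos.to_nat p
  | Zneg p => / w ^ Pos.to_nat p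
  end.

(* Total limit operator on complex sequences, in the style of [Lim_seq]:
   it is the limit whenever the sequence converges (CLim_seq_unique). *)
Definition CLim_seq (u : nat -> C) : C :=
  (real (Lim_seq (fun n => Re (u n))), real (Lim_seq (fun n => Im (u n)))).

Lemma CLim_seq_unique (u : nat -> C) (l : C) :
  filterlim u eventually (locally l) -> CLim_seq u = l.
Proof.
intros H. unfold CLim_seq. destruct l as [x y].
assert (Hx : is_lim_seq (fun n => Re (u n)) x).
{ intros P [e He]. apply (H (fun w => P (Re w))). exists e.
  intros w Hw. apply He. exact (proj1 Hw). }
assert (Hy : is_lim_seq (fun n => Im (u n)) y).
{ intros P [e He]. apply (H (fun w => P (Im w))). exists e.
  intros w Hw. apply He. exact (proj2 Hw). }
now rewrite (is_lim_seq_unique _ _ Hx), (is_lim_seq_unique _ _ Hy).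
Qed.

Definition CSeries (u : nat -> C) : C := CLim_seq (sum_n u).

Fixpoint Cprod (f : nat -> C) (n : nat) : C :=
  match n with
  | O => 1
  | S m => Cprod f m * f m
  end.

Definition binom2 (n : nat) : nat := (n * (n - 1) / 2)%nat.

(* (a;q)_n *)
Definition qpoch (a q : C) (n : nat) : C := Cprod (fun i => 1 - a * q ^ i) n.

(* (a;q)_oo *)
Definition qpoch_inf (a q : C) : C := CLim_seq (qpoch a q).

Definition qGamma (q x : C) : C :=
  qpoch_inf q q / qpoch_inf (Cpower q x) q * Cpower (1 - q) (1 - x).

(* 1 / Gamma_q, with the value 0 at the poles of Gamma_q, which are the zeros
   of (q^x;q)_oo. *)
Definition inv_qGamma (q x : C) : C :=
  if Ceq_dec (qpoch_inf (Cpower q x) q) 0 then 0 else / qGamma q x.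

(* The parameters a_1, ..., a_r and b_1, ..., b_s are the entries of index < r
   of [a] and of index < s of [b]; the other entries are never used.
   The integer exponents of -1 and q may be negative. *)
Definition rRs_term (q : C) (r s : nat) (a b : nat -> C) (alpha beta z : C)
    (l : nat) : C :=
  let e := (1 + Z.of_nat s - Z.of_nat r)%Z in
  z ^ l * CpowerZ (- (1)) (e * Z.of_nat l) * CpowerZ q (e * Z.of_nat (binom2 l))
    / qpoch q q l * inv_qGamma q (INR l * alpha + beta)
  * (Cprod (fun i => qpoch (a i) q l) r / Cprod (fun j => qpoch (b j) q l) s).

Definition rRs (q : C) (r s : nat) (a b : nat -> C) (alpha beta z : C) : C :=
  CSeries (rRs_term q r s a b alpha beta z).

Definition rRs_abs_conv (q : C) (r s : nat) (a b : nat -> C)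
    (alpha beta z : C) : Prop :=
  ex_series (fun l => Cmod (rRs_term q r s a b alpha beta z l)).

(* [v] with its entry of index [i] replaced by [x]. *)
Definition upd (v : nat -> C) (i : nat) (x : C) : nat -> C :=
  fun k => if Nat.eq_dec k i then x else v k.

(* Only meaningful at x <> 0. *)
Definition qderiv (q : C) (f : C -> C) (x : C) : C :=
  (f x - f (q * x)) / ((1 - q) * x).

Definition qderiv_n (q : C) (n : nat) (f : C -> C) : C -> C :=
  Nat.iter n (qderiv q) f.

(* Main.v *)
Require Import Defs.
From Stdlib Require Import Reals ZArith Arith Lia.
From Coquelicot Require Import Coquelicot.
Open Scope C_scope.

(** Both identities are checked on the individual terms of the series.

    The value at [x] of the [n]-fold q-derivative is a finite linear
    combination of the values at [x], [q x], ..., [q^n x]; so if a series of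
    functions converges at these points, it may be q-differentiated [n] times
    term by term ([is_series_qderiv_n]).  This uses only linearity of the sum,
    which is why convergence at finitely many points is enough.

    The [l]-th term depends on [z], [a_i] and [b_j] only through [z^l],
    [(a_i;q)_l] and [1/(b_j;q)_l] respectively ([rRs_term_upd_num],
    [rRs_term_upd_den]).  Write [[k] = (1 - q^k)/(1 - q)].  By induction on [n],
    -  [D^n x^l = [l][l-1]...[l-n+1] x^(l-n)],
    -  [D^n (x;q)_l = (-1)^n q^(n(n-1)/2) [l]...[l-n+1] (x;q)_l / (x;q)_n],
    -  [D^n 1/(x;q)_l = [l][l+1]...[l+n-1] / (x;q)_(l+n)].

    In the first identity both sides therefore produce the falling product
    [[l]...[l-kappa+1]].  In the second one, the factor [z^(kappa-1)] turns
    [z^l] into [z^(l+kappa-1)], whose [kappa]-th q-derivative carries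
    [[l+kappa-1]...[l]], the rising product of the left-hand side read
    backwards; the shift [b_j -> b_j q^kappa] accounts for the denominators,
    as [(b;q)_(l+kappa) = (b;q)_kappa (b q^kappa;q)_l]. *)

(** * Complex numbers and finite products *)

(** The convention [/ 0 = 0] spares the nonvanishing conditions, so that the
    reciprocal of a product of q-shifted factorials can be split for every value
    of the variable, as the extensionality of the q-derivative requires. *)
Lemma Cinv_mul (x y : C) : / (x * y) = / x * / y.
Proof.
destruct x as [a b], y as [c d].
unfold Cinv, Cmult; simpl; unfold Rdiv.
replace ((a * c - b * d) * ((a * c - b * d) * 1)
         + (a * d + b * c) * ((a * d + b * c) * 1))%R
  with ((a * (a * 1) + b * (b * 1)) * (c * (c * 1) + d * (d * 1)))%R by ring.
rewrite Rinv_mult.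
f_equal; ring.
Qed.

Lemma Csub_neq_0 (x y : C) : x <> y -> x - y <> 0.
Proof.
intros H E. apply H. replace x with (x - y + y) by ring. rewrite E. ring.
Qed.

Lemma Cprod_ext (f g : nat -> C) (n : nat) :
  (forall i, (i < n)%nat -> f i = g i) -> Cprod f n = Cprod g n.
Proof.
induction n as [|n IH]; intros H; simpl; [reflexivity|].
rewrite IH by (intros; apply H; lia). rewrite H by lia. reflexivity.
Qed.

Lemma Cprod_S_l (f : nat -> C) (n : nat) :
  Cprod f (S n) = f O * Cprod (fun i => f (S i)) n.
Proof.
induction n as [|n IH]; [simpl; ring|].
change (Cprod f (S (S n))) with (Cprod f (S n) * f (S n)).
rewrite IH. simpl. ring.
Qed.

Lemma Cprod_upd (g : C -> C) (v : nat -> C) (i n : nat) (x : C) :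
  (i < n)%nat ->
  Cprod (fun k => g (upd v i x k)) n
  = g x * Cprod (fun k => if Nat.eq_dec k i then 1 else g (v k)) n.
Proof.
intros Hi. induction n as [|n IH]; [lia|]. simpl. unfold upd at 2.
destruct (Nat.eq_dec n i) as [->|Hne].
- rewrite Cmult_1_r, Cmult_comm. f_equal.
  apply Cprod_ext. intros k Hk. unfold upd.
  destruct (Nat.eq_dec k i); [lia|reflexivity].
- rewrite IH by lia. ring.
Qed.

(** * q-shifted factorials and products of q-numbers *)

Lemma qpoch_S_l (x q : C) (n : nat) :
  qpoch x q (S n) = (1 - x) * qpoch (q * x) q n.
Proof.
unfold qpoch. rewrite Cprod_S_l. f_equal.
- simpl. ring.
- apply Cprod_ext. intros i _. simpl. ring.
Qed.

Lemma qpoch_add (x q : C) (m n : nat) :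
  qpoch x q (m + n) = qpoch x q m * qpoch (x * q ^ m) q n.
Proof.
induction n as [|n IH].
- rewrite Nat.add_0_r. unfold qpoch. simpl. ring.
- rewrite Nat.add_succ_r. unfold qpoch in *. simpl.
  rewrite IH, Cpow_add_r. ring.
Qed.

Lemma qpoch_neq_0 (x q : C) (n : nat) :
  (forall l : nat, x * q ^ l <> 1) -> qpoch x q n <> 0.
Proof.
intros H. unfold qpoch. induction n as [|n IH]; simpl.
- exact C1_nz.
- apply Cmult_neq_0; [exact IH|]. apply Csub_neq_0.
  intros E. now apply (H n).
Qed.

(** The falling product [[l][l-1]...[l-n+1]] of q-numbers.  The truncated difference is harmless: when [n > l],
    the factor of index [l] vanishes. *)
Definition qfalling (q : C) (l n : nat) : C :=
  Cprod (fun i => (1 - q ^ (l - i)) / (1 - q)) n.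

Definition qrising (q : C) (l n : nat) : C :=
  Cprod (fun i => (1 - q ^ (l + i)) / (1 - q)) n.

Lemma qfalling_eq_0 (q : C) (l n : nat) : (l < n)%nat -> qfalling q l n = 0.
Proof.
unfold qfalling. induction n as [|n IH]; intros H; [lia|]. simpl.
destruct (Nat.eq_dec l n) as [->|Hne].
- rewrite Nat.sub_diag. simpl. unfold Cdiv. ring.
- rewrite IH by lia. ring.
Qed.

(** Removes the truncated difference from the last factor of
    [qfalling q l (S n)]; for [l < n] both sides vanish. *)
Lemma qfalling_S (q : C) (l n : nat) :
  1 - q <> 0 ->
  qfalling q l (S n) * (q ^ n * (1 - q)) = qfalling q l n * (q ^ n - q ^ l).
Proof.
intros Hq. destruct (Nat.lt_ge_cases l n) as [H|H].
- rewrite !qfalling_eq_0 by lia. ring.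
- unfold qfalling. simpl.
  replace (q ^ l) with (q ^ n * q ^ (l - n))
    by (rewrite <- Cpow_add_r; f_equal; lia).
  field. exact Hq.
Qed.

Lemma qfalling_qrising (q : C) (l n : nat) :
  qfalling q (l + n) (S n) = qrising q l (S n).
Proof.
induction n as [|n IH].
- unfold qfalling, qrising. simpl. now rewrite Nat.add_0_r, Nat.sub_0_r.
- unfold qfalling. rewrite Cprod_S_l.
  rewrite (Cprod_ext _ (fun i => (1 - q ^ (l + n - i)) / (1 - q)))
    by (intros i _; now rewrite Nat.add_succ_r).
  fold (qfalling q (l + n) (S n)). rewrite IH, Nat.sub_0_r.
  unfold qrising.
  change (Cprod ?f (S (S n))) with (Cprod f (S n) * f (S n)).
  cbv beta. ring.
Qed.

Lemma binom2_S (n : nat) : binom2 (S n) = (binom2 n + n)%nat.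
Proof.
unfold binom2. destruct n as [|n]; [reflexivity|].
replace (S (S n) * (S (S n) - 1))%nat
  with (S n * (S n - 1) + S n * 2)%nat by nia.
apply Nat.div_add. lia.
Qed.

(** * Iterated q-derivatives *)

Lemma qderiv_n_ext (q : C) (n : nat) (f g : C -> C) :
  (forall x, f x = g x) -> forall x, qderiv_n q n f x = qderiv_n q n g x.
Proof.
intros H. induction n as [|n IH]; intros x; simpl; [apply H|].
fold (qderiv_n q n f) (qderiv_n q n g). unfold qderiv. now rewrite !IH.
Qed.

Lemma qderiv_n_scal (q c : C) (n : nat) (f : C -> C) (x : C) :
  qderiv_n q n (fun y => c * f y) x = c * qderiv_n q n f x.
Proof.
revert x. induction n as [|n IH]; intros x; simpl; [reflexivity|].
fold (qderiv_n q n f) (qderiv_n q n (fun y => c * f y)).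
unfold qderiv. rewrite !IH. unfold Cdiv. ring.
Qed.

(** A q-derivative at [x] involves only the values at [x] and [q x]; the points
    needed for [n] further q-derivatives at [q x] are those for [x], shifted by
    one power of [q]. *)
Lemma is_series_qderiv_n (q : C) (n : nat) (f : nat -> C -> C) (F : C -> C)
    (x : C) :
  (forall m : nat, (m <= n)%nat ->
     is_series (V := C_NormedModule) (fun l => f l (q ^ m * x)) (F (q ^ m * x))) ->
  is_series (V := C_NormedModule)
    (fun l => qderiv_n q n (f l) x) (qderiv_n q n F x).
Proof.
revert x. induction n as [|n IH]; intros x H.
- generalize (H O (Nat.le_refl 0)). simpl. now rewrite Cmult_1_l.
- assert (Hx := IH x (fun m Hm => H m (Nat.le_le_succ_r _ _ Hm))).
  assert (Hqx : is_series (V := C_NormedModule)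
    (fun l => qderiv_n q n (f l) (q * x)) (qderiv_n q n F (q * x))).
  { apply IH. intros m Hm.
    replace (q ^ m * (q * x)) with (q ^ S m * x) by (simpl; ring).
    apply H. lia. }
  assert (HD := is_series_scal (V := C_NormedModule) (/ ((1 - q) * x)) _ _
    (is_series_minus (V := C_NormedModule) _ _ _ _ Hx Hqx)).
  replace (qderiv_n q (S n) F x) with
    (@scal C_AbsRing C_NormedModule (/ ((1 - q) * x))
      (@minus C_NormedModule (qderiv_n q n F x) (qderiv_n q n F (q * x)))).
  2: exact (Cmult_comm _ _).
  revert HD. apply is_series_ext. intros l. exact (Cmult_comm _ _).
Qed.

Lemma qderiv_n_pow (q : C) (n l : nat) (x : C) :
  q <> 0 -> 1 - q <> 0 -> x <> 0 ->
  qderiv_n q n (fun y => y ^ l) x = qfalling q l n * x ^ l / x ^ n.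
Proof.
intros Hq Hq1. revert x. induction n as [|n IH]; intros x Hx.
- unfold qfalling. simpl. field.
- change (qderiv q (qderiv_n q n (fun y => y ^ l)) x
          = qfalling q l (S n) * x ^ l / x ^ S n).
  unfold qderiv. rewrite !IH by auto using Cmult_neq_0.
  assert (Hqn := Cpow_nz q n Hq). assert (Hxn := Cpow_nz x n Hx).
  rewrite !Cpow_mult_l, Cpow_S.
  transitivity (qfalling q l n * (q ^ n - q ^ l) * x ^ l
                / (q ^ n * (1 - q) * (x * x ^ n))).
  + field. repeat split; assumption.
  + rewrite <- qfalling_S by exact Hq1. field. repeat split; assumption.
Qed.

(** The induction step compares [(x;q)_l/(x;q)_n] with its value at [q x], where
    each q-shifted factorial [(x;q)_k] becomes [(x;q)_k (1 - x q^k)/(1 - x)]. *)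
Lemma qderiv_n_qpoch (q : C) (n l : nat) (x : C) :
  q <> 0 -> 1 - q <> 0 -> x <> 0 -> (forall i : nat, x * q ^ i <> 1) ->
  qderiv_n q n (fun y => qpoch y q l) x
  = (- (1)) ^ n * q ^ binom2 n / qpoch x q n * qfalling q l n * qpoch x q l.
Proof.
intros Hq Hq1. revert x. induction n as [|n IH]; intros x Hx Hi.
- unfold qfalling, qpoch. simpl. field.
- change (qderiv q (qderiv_n q n (fun y => qpoch y q l)) x
          = (- (1)) ^ S n * q ^ binom2 (S n) / qpoch x q (S n)
            * qfalling q l (S n) * qpoch x q l).
  assert (Hqi : forall i : nat, q * x * q ^ i <> 1).
  { intros i E. apply (Hi (S i)). rewrite <- E. simpl. ring. }
  unfold qderiv. rewrite !IH by auto using Cmult_neq_0.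
  assert (H1x : 1 - x <> 0).
  { apply Csub_neq_0. intros E. apply (Hi O). rewrite <- E. simpl. ring. }
  assert (Hsh : forall k, qpoch (q * x) q k
                          = qpoch x q k * (1 - x * q ^ k) / (1 - x)).
  { intros k. change (qpoch x q k * (1 - x * q ^ k)) with (qpoch x q (S k)).
    rewrite qpoch_S_l. field. exact H1x. }
  rewrite !Hsh.
  assert (Hpn := qpoch_neq_0 x q n Hi).
  assert (Hn : 1 - x * q ^ n <> 0).
  { apply Csub_neq_0. intros E. now apply (Hi n). }
  change (qpoch x q (S n)) with (qpoch x q n * (1 - x * q ^ n)).
  rewrite binom2_S, Cpow_add_r, Cpow_S.
  transitivity (- (- (1)) ^ n * q ^ binom2 n * qpoch x q l
                * (qfalling q l n * (q ^ n - q ^ l))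
                / ((1 - q) * (qpoch x q n * (1 - x * q ^ n)))).
  + field. repeat split; assumption.
  + rewrite <- qfalling_S by exact Hq1. field. repeat split; assumption.
Qed.

Lemma qderiv_n_inv_qpoch (q : C) (n l : nat) (x : C) :
  q <> 0 -> 1 - q <> 0 -> x <> 0 -> (forall i : nat, x * q ^ i <> 1) ->
  qderiv_n q n (fun y => / qpoch y q l) x = qrising q l n / qpoch x q (l + n).
Proof.
intros Hq Hq1. revert x. induction n as [|n IH]; intros x Hx Hi.
- rewrite Nat.add_0_r. unfold qrising. simpl. unfold Cdiv. ring.
- change (qderiv q (qderiv_n q n (fun y => / qpoch y q l)) x
          = qrising q l (S n) / qpoch x q (l + S n)).
  assert (Hqi : forall i : nat, q * x * q ^ i <> 1).
  { intros i E. apply (Hi (S i)). rewrite <- E. simpl. ring. }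
  unfold qderiv. rewrite !IH by auto using Cmult_neq_0.
  assert (Hx0 := qpoch_neq_0 x q (l + n) Hi).
  assert (Hx1 := qpoch_neq_0 (q * x) q (l + n) Hqi).
  assert (Hn : 1 - x * q ^ (l + n) <> 0).
  { apply Csub_neq_0. intros E. now apply (Hi (l + n)%nat). }
  (* [(x;q)_(l+n+1)] is split at both ends. *)
  assert (E : qpoch x q (l + n) * (1 - x * q ^ (l + n))
              = (1 - x) * qpoch (q * x) q (l + n)).
  { rewrite <- qpoch_S_l. reflexivity. }
  rewrite Nat.add_succ_r.
  change (qpoch x q (S (l + n))) with (qpoch x q (l + n) * (1 - x * q ^ (l + n))).
  change (qrising q l (S n)) with (qrising q l n * ((1 - q ^ (l + n)) / (1 - q))).
  assert (Hinv : / qpoch (q * x) q (l + n)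
                 = (1 - x) / (qpoch x q (l + n) * (1 - x * q ^ (l + n)))).
  { assert (H1x : 1 - x <> 0).
    { apply Csub_neq_0. intros E0. apply (Hi O). rewrite <- E0. simpl. ring. }
    rewrite E. field. split; assumption. }
  unfold Cdiv at 3. rewrite Hinv.
  field. repeat split; assumption.
Qed.

(** * The terms of the basic function *)

Lemma is_series_rRs (q : C) (r s : nat) (a b : nat -> C) (alpha beta z : C) :
  rRs_abs_conv q r s a b alpha beta z ->
  is_series (V := C_NormedModule)
    (rRs_term q r s a b alpha beta z) (rRs q r s a b alpha beta z).
Proof.
intros H.
destruct (ex_series_le (V := C_CompleteNormedModule)
            (rRs_term q r s a b alpha beta z) _ (fun n => Rle_refl _) H)
  as [S HS].
replace (rRs q r s a b alpha beta z) with S; [exact HS|].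
symmetry. exact (CLim_seq_unique _ S HS).
Qed.

Definition rRs_coef (q : C) (r s : nat) (alpha beta : C) (l : nat) : C :=
  let e := (1 + Z.of_nat s - Z.of_nat r)%Z in
  CpowerZ (- (1)) (e * Z.of_nat l) * CpowerZ q (e * Z.of_nat (binom2 l))
    / qpoch q q l * inv_qGamma q (INR l * alpha + beta).

Definition qpoch_others (q : C) (v : nat -> C) (i n l : nat) : C :=
  Cprod (fun k => if Nat.eq_dec k i then 1 else qpoch (v k) q l) n.

(** Isolates the dependence on the [i]-th numerator parameter and on [z], the two
    variables of the first identity. *)
Lemma rRs_term_upd_num (q : C) (r s : nat) (a b : nat -> C)
    (alpha beta z x : C) (i l : nat) :
  (i < r)%nat ->
  rRs_term q r s (upd a i x) b alpha beta z l
  = rRs_coef q r s alpha beta l * qpoch_others q a i r l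
      / Cprod (fun j => qpoch (b j) q l) s * z ^ l * qpoch x q l.
Proof.
intros Hi. unfold rRs_term, rRs_coef, qpoch_others.
rewrite (Cprod_upd (fun y => qpoch y q l)) by exact Hi.
unfold Cdiv. ring.
Qed.

Lemma rRs_term_upd_den (q : C) (r s : nat) (a b : nat -> C)
    (alpha beta z x : C) (j l : nat) :
  (j < s)%nat ->
  rRs_term q r s a (upd b j x) alpha beta z l
  = rRs_coef q r s alpha beta l * Cprod (fun i => qpoch (a i) q l) r
      / qpoch_others q b j s l * z ^ l * / qpoch x q l.
Proof.
intros Hj. unfold rRs_term, rRs_coef, qpoch_others.
rewrite (Cprod_upd (fun y => qpoch y q l)) by exact Hj.
unfold Cdiv. rewrite Cinv_mul. ring.
Qed.

Lemma rRs_term_upd_same (q : C) (r s : nat) (a b : nat -> C)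
    (alpha beta z : C) (i l : nat) :
  rRs_term q r s (upd a i (a i)) b alpha beta z l
  = rRs_term q r s a b alpha beta z l.
Proof.
unfold rRs_term. do 2 f_equal. apply Cprod_ext. intros k _. unfold upd.
now destruct (Nat.eq_dec k i) as [->|].
Qed.

(** * The two identities *)

Lemma is_series_proportional (c : C) (u v : nat -> C) (lu lv : C) :
  is_series (V := C_NormedModule) u lu ->
  is_series (V := C_NormedModule) v lv ->
  (forall l, u l = c * v l) -> lu = c * lv.
Proof.
intros Hu Hv E.
assert (Hcv : is_series (V := C_NormedModule) u (c * lv)).
{ apply (is_series_ext (V := C_NormedModule) (fun l => c * v l)).
  - intros l. symmetry. apply E.
  - exact (is_series_scal (V := C_NormedModule) c v lv Hv). }
rewrite <- (CLim_seq_unique _ _ Hu). exact (CLim_seq_unique _ _ Hcv).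
Qed.

Lemma qderiv_n_rRs_num (q : C) (r s : nat) (a b : nat -> C) (alpha beta z : C)
    (n i : nat) :
  q <> 0 -> 1 - q <> 0 -> z <> 0 -> a i <> 0 -> (i < r)%nat ->
  (forall l : nat, a i * q ^ l <> 1) ->
  (forall m : nat, (m <= n)%nat ->
     rRs_abs_conv q r s a b alpha beta (q ^ m * z)) ->
  (forall m : nat, (m <= n)%nat ->
     rRs_abs_conv q r s (upd a i (q ^ m * a i)) b alpha beta z) ->
  qderiv_n q n (fun x => rRs q r s (upd a i x) b alpha beta z) (a i)
  = (- (1)) ^ n * q ^ binom2 n / qpoch (a i) q n * z ^ n
    * qderiv_n q n (fun x => rRs q r s a b alpha beta x) z.
Proof.
intros Hq Hq1 Hz Ha Hi Hai Cz Ca.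
apply (is_series_proportional _
  (fun l => qderiv_n q n
     (fun x => rRs_term q r s (upd a i x) b alpha beta z l) (a i))
  (fun l => qderiv_n q n (fun x => rRs_term q r s a b alpha beta x l) z)).
- apply (is_series_qderiv_n q n
    (fun l x => rRs_term q r s (upd a i x) b alpha beta z l)
    (fun x => rRs q r s (upd a i x) b alpha beta z)).
  intros m Hm. now apply is_series_rRs, Ca.
- apply (is_series_qderiv_n q n (fun l x => rRs_term q r s a b alpha beta x l)).
  intros m Hm. now apply is_series_rRs, Cz.
- intros l.
  set (W := rRs_coef q r s alpha beta l * qpoch_others q a i r l
              / Cprod (fun j => qpoch (b j) q l) s).
  rewrite (qderiv_n_ext _ _ _ (fun x => W * z ^ l * qpoch x q l))
    by (intros x; now apply rRs_term_upd_num).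
  rewrite (qderiv_n_ext _ _ (fun x => rRs_term q r s a b alpha beta x l)
             (fun x => W * qpoch (a i) q l * x ^ l)).
  2:{ intros x. rewrite <- (rRs_term_upd_same _ _ _ _ _ _ _ _ i).
      rewrite rRs_term_upd_num by exact Hi. fold W. ring. }
  rewrite !qderiv_n_scal, qderiv_n_qpoch, qderiv_n_pow by assumption.
  field. split; [now apply Cpow_nz | now apply qpoch_neq_0].
Qed.

(** The order of differentiation is written [S n] so that the exponent
    [kappa - 1] of the statement is [n], without truncated difference. *)
Lemma qderiv_n_rRs_den (q : C) (r s : nat) (a b : nat -> C) (alpha beta z : C)
    (n j : nat) :
  q <> 0 -> 1 - q <> 0 -> z <> 0 -> b j <> 0 -> (j < s)%nat ->
  (forall l : nat, b j * q ^ l <> 1) ->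
  (forall m : nat, (m <= S n)%nat ->
     rRs_abs_conv q r s a (upd b j (q ^ m * b j)) alpha beta z) ->
  (forall m : nat, (m <= S n)%nat ->
     rRs_abs_conv q r s a (upd b j (b j * q ^ S n)) alpha beta (q ^ m * z)) ->
  qderiv_n q (S n) (fun x => rRs q r s a (upd b j x) alpha beta z) (b j)
  = z / qpoch (b j) q (S n)
    * qderiv_n q (S n)
        (fun x => x ^ n * rRs q r s a (upd b j (b j * q ^ S n)) alpha beta x) z.
Proof.
intros Hq Hq1 Hz Hb Hj Hbj Cb Cz.
apply (is_series_proportional _
  (fun l => qderiv_n q (S n)
     (fun x => rRs_term q r s a (upd b j x) alpha beta z l) (b j))
  (fun l => qderiv_n q (S n)
     (fun x => x ^ n * rRs_term q r s a (upd b j (b j * q ^ S n)) alpha beta x l)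
     z)).
- apply (is_series_qderiv_n q (S n)
    (fun l x => rRs_term q r s a (upd b j x) alpha beta z l)
    (fun x => rRs q r s a (upd b j x) alpha beta z)).
  intros m Hm. now apply is_series_rRs, Cb.
- apply (is_series_qderiv_n q (S n) (fun l x =>
    x ^ n * rRs_term q r s a (upd b j (b j * q ^ S n)) alpha beta x l)).
  intros m Hm.
  apply (is_series_scal (V := C_NormedModule) ((q ^ m * z) ^ n)).
  now apply is_series_rRs, Cz.
- intros l.
  set (W := rRs_coef q r s alpha beta l * Cprod (fun i => qpoch (a i) q l) r
              / qpoch_others q b j s l).
  rewrite (qderiv_n_ext _ _ _ (fun x => W * z ^ l * / qpoch x q l))
    by (intros x; now apply rRs_term_upd_den).
  rewrite (qderiv_n_ext _ _
             (fun x => x ^ n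
                * rRs_term q r s a (upd b j (b j * q ^ S n)) alpha beta x l)
             (fun x => W * / qpoch (b j * q ^ S n) q l * x ^ (l + n))).
  2:{ intros x. rewrite rRs_term_upd_den by exact Hj. fold W.
      rewrite Cpow_add_r. ring. }
  rewrite !qderiv_n_scal, qderiv_n_inv_qpoch, qderiv_n_pow by assumption.
  rewrite qfalling_qrising, (Nat.add_comm l (S n)), qpoch_add.
  rewrite Cpow_add_r, (Cpow_S z n).
  assert (Hzn := Cpow_nz z n Hz).
  assert (Hp := qpoch_neq_0 (b j) q (S n) Hbj).
  assert (Hp' : qpoch (b j * q ^ S n) q l <> 0).
  { apply qpoch_neq_0. intros k E. apply (Hbj (S n + k)%nat).
    rewrite <- E, Cpow_add_r. ring. }
  field. repeat split; assumption.
Qed.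

Theorem theorem8 :
  forall (q : C) (r s : nat) (a b : nat -> C) (alpha beta z : C) (kappa : nat),
  (0 < Cmod q < 1)%R ->
  (1 <= r)%nat -> (1 <= s)%nat ->
  z <> 0 ->
  (forall i l : nat, (i < r)%nat -> a i * q ^ l <> 1) ->
  (forall j l : nat, (j < s)%nat -> b j * q ^ l <> 1) ->
  (1 <= kappa)%nat ->
  (* absolute convergence of every series occurring in the two identities *)
  (forall m : nat, (m <= kappa)%nat ->
     rRs_abs_conv q r s a b alpha beta (q ^ m * z)) ->
  (forall i m : nat, (i < r)%nat -> (m <= kappa)%nat ->
     rRs_abs_conv q r s (upd a i (q ^ m * a i)) b alpha beta z) ->
  (forall j m : nat, (j < s)%nat -> (m <= kappa)%nat ->
     rRs_abs_conv q r s a (upd b j (q ^ m * b j)) alpha beta z) ->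
  (forall j m : nat, (j < s)%nat -> (m <= kappa)%nat ->
     rRs_abs_conv q r s a (upd b j (b j * q ^ kappa)) alpha beta (q ^ m * z)) ->
  (forall i : nat, (i < r)%nat -> a i <> 0 ->
     qderiv_n q kappa (fun x => rRs q r s (upd a i x) b alpha beta z) (a i)
     = (- (1)) ^ kappa * q ^ binom2 kappa / qpoch (a i) q kappa
       * z ^ kappa * qderiv_n q kappa (fun x => rRs q r s a b alpha beta x) z)
  /\
  (forall j : nat, (j < s)%nat -> b j <> 0 ->
     qderiv_n q kappa (fun x => rRs q r s a (upd b j x) alpha beta z) (b j)
     = z / qpoch (b j) q kappa
       * qderiv_n q kappa
           (fun x => x ^ (kappa - 1)
                     * rRs q r s a (upd b j (b j * q ^ kappa)) alpha beta x) z).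
Proof.
intros q r s a b alpha beta z kappa [Hq0 Hq1] _ _ Hz Ha Hb Hk Cz Ca Cb Cbz.
assert (Hq : q <> 0) by (apply Cmod_gt_0; exact Hq0).
assert (H1q : 1 - q <> 0).
{ apply Csub_neq_0. intros E. rewrite <- E, Cmod_1 in Hq1.
  exact (Rlt_irrefl _ Hq1). }
split.
- intros i Hi Hai.
  apply qderiv_n_rRs_num; auto.
- intros j Hj Hbj. destruct kappa as [|n]; [lia|].
  replace (S n - 1)%nat with n by lia.
  apply qderiv_n_rRs_den; auto.
Qed.
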